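(* Let $H$ be a weighted hypergraph with vertices $v_1,\dots,v_n$ and hyperedges $e_1,\dots,e_m$ (every vertex in some hyperedge, every hyperedge with non-empty support), with spectral decomposition $V=\bigsqcup_{r=1}^kV_{\alpha_r}$, $E=\bigsqcup_{r=1}^kE_{\alpha_r}$. Then there exists a support matrix $A$ for $H$ such that for every $r$ and every vertex $v_j\in V_{\alpha_r}$ the column sum $s_j(A)$ equals $\alpha_r$. Any such matrix has a block decomposition with blocks corresponding to the factors $(V_{\alpha_1},E_{\alpha_1}),\dots,(V_{\alpha_k},E_{\alpha_k})$, i.e. $a_{ij}=0$ unless $v_j\in V_{\alpha_r}$ and $e_i\in E_{\alpha_r}$ for the same $r$.
   Context: A weighted hypergraph $H=(V,E,\mathrm{supp})$ has vertices $v_j$ with weights $w_j>0$, hyperedges $e_i$ with weights $u_i>0$, and support map $\mathrm{supp}:E\to\mathcal P(V)$; $\mathrm{wt}$ of a set is the sum of weights. A subgraph is a pair $(V',E')$ with $\mathrm{supp}(e)\subset V'$ for all $e\in E'$; its density is $\mathrm{wt}(E')/\mathrm{wt}(V')$. A quotient hypergraph is a pair $(V'',E'')$ such that every hyperedge whose support meets $V''$ lies in $E''$, with supports $\mathrm{supp}(e)\cap V''$. There is a unique subgraph of maximum density maximal under componentwise inclusion. The spectral decomposition is defined inductively: $(V_{\alpha_t},E_{\alpha_t})$ is the maximal subgraph of maximum density $\alpha_t$ in the quotient hypergraph $(V\setminus\bigcup_{r<t}V_{\alpha_r},E\setminus\bigcup_{r<t}E_{\alpha_r})$. A support matrix is a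 real $m\times n$ matrix $A=(a_{ij})$ with $a_{ij}\ge0$, $a_{ij}=0$ whenever $v_j\notin\mathrm{supp}(e_i)$, and $\sum_jw_ja_{ij}=u_i$ for all $i$; $s_j(A)=\sum_ia_{ij}$. *)

(* Defs.v *)
From HB Require Import structures.
From mathcomp Require Import all_boot all_order all_algebra.
From mathcomp Require Import reals.
Set Implicit Arguments.
Unset Strict Implicit.
Unset Printing Implicit Defensive.
Import Order.TTheory GRing.Theory Num.Theory.
Local Open Scope ring_scope.

(* Hyperedges are indices, not subsets: several may share the same support. *)
Record whypergraph (R : realType) (n m : nat) := WHypergraph {
  vweight : 'I_n -> R;
  eweight : 'I_m -> R;
  supp : 'I_m -> {set 'I_n};
  vweight_gt0 : forall j, 0 < vweight j;
  eweight_gt0 : forall i, 0 < eweight i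
}.

Section Hypergraphs.
Variables (R : realType) (n m : nat) (H : whypergraph R n m).

(* The vertex set and the hyperedge set of a subgraph or of a quotient of H. *)
Definition hpart : Type := ({set 'I_n} * {set 'I_m})%type.

Definition vwt (V' : {set 'I_n}) : R := \sum_(j in V') vweight H j.
Definition ewt (E' : {set 'I_m}) : R := \sum_(i in E') eweight H i.

(* Only meaningful when S.1 is nonempty. *)
Definition density (S : hpart) : R := ewt S.2 / vwt S.1.

Definition is_quotient (Q : hpart) : Prop :=
  forall i, supp H i :&: Q.1 != set0 -> i \in Q.2.

Definition qsupp (Q : hpart) (i : 'I_m) : {set 'I_n} := supp H i :&: Q.1.

(* S is a subgraph of the quotient Q; Q := ([set: _], [set: _]) is H itself. *)
Definition is_subgraph (Q S : hpart) : Prop :=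
  [/\ S.1 \subset Q.1, S.2 \subset Q.2
    & forall i, i \in S.2 -> qsupp Q i \subset S.1].

Definition is_densest (Q S : hpart) : Prop :=
  [/\ is_subgraph Q S, S.1 != set0
    & forall T, is_subgraph Q T -> T.1 != set0 -> density T <= density S].

Definition is_max_densest (Q S : hpart) : Prop :=
  is_densest Q S /\
  forall T, is_densest Q T -> S.1 \subset T.1 -> S.2 \subset T.2 -> T = S.

Definition remainder (k : nat) (Vs : 'I_k -> {set 'I_n})
    (Es : 'I_k -> {set 'I_m}) (t : 'I_k) : hpart :=
  ([set: 'I_n] :\: \bigcup_(r < k | (r < t)%N) Vs r,
   [set: 'I_m] :\: \bigcup_(r < k | (r < t)%N) Es r).

(* Pairwise disjointness of the factors is automatic: each factor lies in the
   remainder left by the previous ones. *)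
Definition spectral_decomposition (k : nat) (alpha : 'I_k -> R)
    (Vs : 'I_k -> {set 'I_n}) (Es : 'I_k -> {set 'I_m}) : Prop :=
  [/\ forall t, is_max_densest (remainder Vs Es t) (Vs t, Es t),
      forall t, alpha t = density (Vs t, Es t),
      \bigcup_(t < k) Vs t = [set: 'I_n]
    & \bigcup_(t < k) Es t = [set: 'I_m]].

Definition is_support_matrix (A : 'M[R]_(m, n)) : Prop :=
  [/\ forall i j, 0 <= A i j,
      forall i j, j \notin supp H i -> A i j = 0
    & forall i, \sum_(j < n) vweight H j * A i j = eweight H i].

Definition colsum (A : 'M[R]_(m, n)) (j : 'I_n) : R := \sum_(i < m) A i j.

Lemma remainder_is_quotient (k : nat) (alpha : 'I_k -> R)
    (Vs : 'I_k -> {set 'I_n}) (Es : 'I_k -> {set 'I_m}) :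
  spectral_decomposition alpha Vs Es ->
  forall t, is_quotient (remainder Vs Es t).
Proof.
case=> hmax _ _ _ t i /set0Pn[j]; rewrite !inE andbT => /andP[ji jV].
rewrite andbT; apply: contra jV => /bigcupP[r rt ir].
have [[[_ _ hr] _ _] _] := hmax r.
have := subsetP (hr i ir) j; rewrite /qsupp !inE ji andbT /=.
have [/bigcupP[s sr js] _|_ /(_ isT) jr] :=
  boolP (j \in \bigcup_(s < k | (s < r)%N) Vs s).
  by apply/bigcupP; exists s => //; exact: ltn_trans sr rt.
by apply/bigcupP; exists r.
Qed.

End Hypergraphs.

(* Main.v *)
(** Maximality of the density [alpha_r] in each successive quotient is a Hall
condition: every set [F] of hyperedges of the [r]-th factor has weight at most
[alpha_r] times the weight of the vertices of that factor that it meets.  The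
fractional Hall theorem distributes the weight [u_i] of each hyperedge over the
vertices of its own factor so that [v_j] receives at most [alpha_r w_j], and
this is an equality because the total weights agree.  Conversely, a hyperedge
of a factor is supported in this factor and the previous ones, and comparing
weights over the first [t] factors for every [t] forces the block form. *)
Require Import Defs.
From HB Require Import structures.
From mathcomp Require Import all_boot all_order all_algebra.
From mathcomp Require Import reals lra.
Set Implicit Arguments.
Unset Strict Implicit.
Unset Printing Implicit Defensive.
Import Order.TTheory GRing.Theory Num.Theory.
Local Open Scope ring_scope.

(** * Sums of non-negative weights over finite sets *)

Section SetSums.
Variables (R : realFieldType) (T : finType).
Implicit Types (f : T -> R) (A B : {set T}).

Lemma sum_setUI f A B :
  \sum_(x in A :|: B) f x + \sum_(x in A :&: B) f x =
  \sum_(x in A) f x + \sum_(x in B) f x.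
Proof.
rewrite (big_setID A) /= setUK setDUl setDv set0U.
by rewrite -addrA [X in _ + X]addrC setIC -big_setID.
Qed.

Lemma sum_setS f A B : (forall x, 0 <= f x) -> A \subset B ->
  \sum_(x in A) f x <= \sum_(x in B) f x.
Proof.
move=> f0 AB; rewrite [leRHS](big_setID A) /= (setIidPr AB) lerDl.
by apply: sumr_ge0.
Qed.

Lemma sum_subU1 f A B a : (forall x, 0 <= f x) -> B \subset a |: A ->
  \sum_(x in B) f x <= f a + \sum_(x in A) f x.
Proof.
move=> f0 BA; apply: le_trans (sum_setS f0 BA) _.
have := sum_setUI f [set a] A; rewrite big_set1 => <-.
by rewrite lerDl sumr_ge0.
Qed.

Lemma sum_sub_delta f A a d :
  \sum_(x in A) (f x - (if x == a then d else 0)) =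
  \sum_(x in A) f x - (if a \in A then d else 0).
Proof.
rewrite sumrB -big_mkcondr; congr (_ - _); case: ifP => aA.
  by rewrite (big_pred1 a) // => x /=; case: eqP => [->|]; rewrite ?aA ?andbF.
by rewrite big_pred0 // => x; case: eqP => [->|]; rewrite ?aA ?andbF.
Qed.

End SetSums.

(** * A fractional Hall theorem for bipartite graphs *)

Section FractionalHall.
Variables (R : realFieldType) (I J : finType).
Implicit Types (S : {set I * J}) (F G : {set I}).

(** The graph is a set of pairs, so that an induction on its cardinality can delete one pair at a
    time. *)
Definition nbr S G : {set J} := [set j | [exists i in G, (i, j) \in S]].

Lemma nbrP S G j :
  reflect (exists2 i, i \in G & (i, j) \in S) (j \in nbr S G).
Proof. by rewrite inE; apply: exists_inP. Qed.

Lemma nbrU S F G : nbr S (F :|: G) = nbr S F :|: nbr S G.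
Proof.
apply/setP=> j; apply/nbrP/setUP => [[i /setUP[iF|iG] ij]|[]/nbrP[i iF ij]].
- by left; apply/nbrP; exists i.
- by right; apply/nbrP; exists i.
- by exists i => //; rewrite inE iF.
- by exists i => //; rewrite inE iF orbT.
Qed.

Lemma nbrS S F G : F \subset G -> nbr S F \subset nbr S G.
Proof.
by move=> FG; apply/subsetP=> j /nbrP[i /(subsetP FG) iG ij]; apply/nbrP; exists i.
Qed.

Lemma nbrD1_notin S G i j : i \notin G -> nbr (S :\ (i, j)) G = nbr S G.
Proof.
move=> iG; apply/setP=> y; apply/nbrP/nbrP => -[x xG xy]; exists x => //.
  by case/setD1P: xy.
by apply/setD1P; split=> //; apply: contraNneq iG => -[<- _].
Qed.

Lemma nbrD1_sub S G i j : nbr S G \subset j |: nbr (S :\ (i, j)) G.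
Proof.
apply/subsetP=> y /nbrP[x xG xy]; rewrite in_setU1.
have [//|yj] := eqVneq y j; apply/nbrP; exists x => //.
by apply/setD1P; split=> //; apply: contraNneq yj => -[_ ->].
Qed.

(** Induction on the number of pairs: delete a pair after sending along it just enough weight for
    Hall's condition to survive. *)
Lemma fractional_hall S (u : I -> R) (c : J -> R) :
    (forall i, 0 <= u i) -> (forall j, 0 <= c j) ->
    (forall G, \sum_(i in G) u i <= \sum_(j in nbr S G) c j) ->
  exists B : I -> J -> R,
    [/\ forall i j, 0 <= B i j,
        forall i j, (i, j) \notin S -> B i j = 0,
        forall i, \sum_j B i j = u i
      & forall j, \sum_i B i j <= c j].
Proof.
have [N] := ubnP #|S|; elim: N S u c => // N IH S u c leSN u0 c0 hall.
have [S0|[[i j] ijS]] := set_0Vmem S.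
  (* With no pair left, Hall's condition on singletons forces every [u i] to vanish. *)
  exists (fun _ _ => 0); split=> // [i|j]; last by rewrite big1.
  rewrite big1 //; apply/le_anti; rewrite u0 /=.
  have := hall [set i]; rewrite big_set1 big_pred0 // => y.
  by apply/negP => /nbrP[x _]; rewrite S0 inE.
pose S' := S :\ (i, j).
pose deficit G := \sum_(x in G) u x - \sum_(y in nbr S' G) c y.
(* [d] is the least amount that [i] has to send to [j]: after sending it, Hall's
   condition survives the removal of the pair (submodularity, in [key]). *)
pose F := [arg max_(G > set0) deficit G]%O; pose d := deficit F.
have dmax G : deficit G <= d.
  by rewrite /d /F; case: Order.TotalTheory.arg_maxP => // G0 _; apply.
have d0 : 0 <= d.
  apply: le_trans (dmax set0); rewrite /deficit big_set0 big_pred0 ?subr0 //.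
  by move=> y; apply/negP => /nbrP[x]; rewrite inE.
(* Deleting the pair does not affect the neighbours of [F :\ i], so Hall's condition there leaves
   [F] a deficit of at most [u i]. *)
have le_du : d <= u i.
  have sF : nbr S (F :\ i) \subset nbr S' F.
    by rewrite -(@nbrD1_notin _ _ i j) ?setD11 // nbrS // subsetDl.
  have FU : F \subset i |: F :\ i.
    by apply/subsetP=> x xF; rewrite !inE xF andbT orbN.
  have := le_trans (hall (F :\ i)) (sum_setS c0 sF).
  by have := sum_subU1 u0 FU; rewrite /d /deficit; lra.
have le_dc : d <= c j.
  have := le_trans (hall F) (sum_subU1 c0 (nbrD1_sub S F i j)).
  by rewrite /d /deficit -/S'; lra.
have key G : i \notin G -> j \in nbr S G ->
    \sum_(x in G) u x <= \sum_(y in nbr S G) c y - d.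
  move=> iG jG.
  have hU := hall (G :|: F); have hI := hall (G :&: F).
  have sU : nbr S (G :|: F) \subset nbr S G :|: nbr S' F.
    rewrite nbrU subUset subsetUl; apply: subset_trans (nbrD1_sub _ _ i j) _.
    by rewrite subUset subsetUr sub1set inE jG.
  have sI : nbr S (G :&: F) \subset nbr S G :&: nbr S' F.
    rewrite subsetI nbrS ?subsetIl //= -(@nbrD1_notin _ _ i j) ?nbrS ?subsetIr //.
    by rewrite inE negb_and iG.
  have := le_trans hU (sum_setS c0 sU); have := le_trans hI (sum_setS c0 sI).
  have := sum_setUI u G F; have := sum_setUI c (nbr S G) (nbr S' F).
  by rewrite /d /deficit; lra.
have [||||B [B0 BS Bu Bc]] := IH S' (fun x => u x - (if x == i then d else 0))
    (fun y => c y - (if y == j then d else 0)).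
- by move: leSN; rewrite (cardsD1 (i, j)) ijS.
- by move=> x; case: eqP => [->|_]; rewrite ?subr0 // subr_ge0.
- by move=> y; case: eqP => [->|_]; rewrite ?subr0 // subr_ge0.
- move=> G; rewrite !sum_sub_delta.
  have dG := dmax G; rewrite /deficit in dG.
  (* If [i] is in [G], either both sides lose [d] and [G] has kept all its neighbours, or only the
     left side does and the maximality of [d] suffices. *)
  have [iG|iG] := boolP (i \in G).
    case: ifP => jG; last by lra.
    have sG : nbr S G \subset nbr S' G.
      by apply: subset_trans (nbrD1_sub _ _ i j) _; rewrite subUset sub1set jG /=.
    by have := le_trans (hall G) (sum_setS c0 sG); lra.
  rewrite nbrD1_notin //; case: ifP => jG; rewrite subr0; first exact: key.
  by rewrite subr0.
exists (fun x y => B x y + (if (x == i) && (y == j) then d else 0)); split.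
- by move=> x y; rewrite addr_ge0 //; case: ifP.
- move=> x y xy; rewrite BS ?add0r; last by rewrite in_setD1 negb_and xy orbT.
  by case: andP => // -[/eqP xi /eqP yj]; rewrite xi yj ijS in xy.
- move=> x; rewrite big_split /= Bu; case: eqP => _ /=.
    by rewrite -big_mkcond big_pred1_eq subrK.
  by rewrite big1 // subr0 addr0.
- move=> y; rewrite big_split /= -lerBrDr; apply: le_trans (Bc y) _.
  rewrite lerD2l lerN2; case: (y == j); under eq_bigr do rewrite ?andbT ?andbF.
    by rewrite -big_mkcond big_pred1_eq.
  by rewrite big1.
Qed.

End FractionalHall.

(** * Successive remainders described by labels *)

Section SuccessiveDifferences.
Variables (T : finType) (k : nat) (Xs : 'I_k -> {set T}).

Let rest (t : 'I_k) : {set T} := [set: T] :\: \bigcup_(r < k | (r < t)%N) Xs r.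

Lemma mem_rest (t : 'I_k) x :
  reflect (forall r : 'I_k, (r < t)%N -> x \notin Xs r) (x \in rest t).
Proof.
rewrite /rest inE in_setT andbT; apply: (iffP negP) => h.
  by move=> r rt; apply/negP => xr; apply: h; apply/bigcupP; exists r.
by case/bigcupP=> r rt; apply/negP/h.
Qed.

(** Each set avoids the earlier ones, so the sets are disjoint; as they also cover, every element
    lies in exactly one, whose index is its label. *)
Lemma successive_label :
    (forall t, Xs t \subset rest t) -> \bigcup_(t < k) Xs t = [set: T] ->
  exists lab : T -> 'I_k, forall x r, (x \in Xs r) = (lab x == r).
Proof.
move=> sub cover.
have ex x : exists r, x \in Xs r.
  by have := in_setT x; rewrite -cover => /bigcupP[r _ xr]; exists r.
have [lab labP] := fin_all_exists ex; exists lab => x r.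
apply/idP/eqP => [xr|<-] //; apply/val_inj.
have lt_notin (s t : 'I_k) : (s < t)%N -> x \in Xs s -> x \notin Xs t.
  by move=> st; apply: contraL => /(subsetP (sub t))/mem_rest; apply.
case: (ltngtP (lab x) r) => // [/lt_notin /(_ (labP x))|/lt_notin /(_ xr)].
  by rewrite xr.
by rewrite labP.
Qed.

Lemma mem_rest_label (lab : T -> 'I_k) (t : 'I_k) x :
  (forall x r, (x \in Xs r) = (lab x == r)) -> (x \in rest t) = (t <= lab x)%N.
Proof.
move=> labE; rewrite leqNgt; apply/mem_rest/negP => [h xt|h r rt].
  by have := h _ xt; rewrite labE eqxx.
by rewrite labE; apply: contra_notN h => /eqP ->.
Qed.

End SuccessiveDifferences.

(** * Spectral factors, their Hall condition and the block form *)

Section SpectralFactors.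
Variables (R : realType) (n m : nat) (H : whypergraph R n m).
Variables (k : nat) (alpha : 'I_k -> R).
Variables (Vs : 'I_k -> {set 'I_n}) (Es : 'I_k -> {set 'I_m}).
Lemma vwt_ge0 (V' : {set 'I_n}) : 0 <= vwt H V'.
Proof. by apply: sumr_ge0 => j _; rewrite ltW // vweight_gt0. Qed.

Lemma vwt_gt0 (V' : {set 'I_n}) : V' != set0 -> 0 < vwt H V'.
Proof.
case/set0Pn=> j jV; rewrite /vwt (bigD1 j) //=.
apply: ltr_wpDr (vweight_gt0 H j).
by apply: sumr_ge0 => x _; rewrite ltW // vweight_gt0.
Qed.

Hypothesis hspec : spectral_decomposition H alpha Vs Es.

Lemma spectral_subgraph t : is_subgraph H (remainder Vs Es t) (Vs t, Es t).
Proof. by case: hspec => /(_ t)[[]]. Qed.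

Lemma spectral_vertex_label :
  exists rv : 'I_n -> 'I_k, forall j r, (j \in Vs r) = (rv j == r).
Proof.
have [_ _ cover _] := hspec; apply: successive_label cover => t.
by have [] := spectral_subgraph t.
Qed.

Lemma spectral_edge_label :
  exists re : 'I_m -> 'I_k, forall i r, (i \in Es r) = (re i == r).
Proof.
have [_ _ _ cover] := hspec; apply: successive_label cover => t.
by have [] := spectral_subgraph t.
Qed.

Lemma spectral_alpha_vwt t : alpha t * vwt H (Vs t) = ewt H (Es t).
Proof.
have [/(_ t)[[_ V0 _] _] /(_ t) -> _ _] := hspec.
by rewrite divfK // gt_eqF // vwt_gt0.
Qed.

Lemma alpha_ge0 t : 0 <= alpha t.
Proof.
have [_ -> _ _] := hspec; apply: divr_ge0 (vwt_ge0 _).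
by apply: sumr_ge0 => i _; rewrite ltW // eweight_gt0.
Qed.

Lemma spectral_ewt_le t S : is_subgraph H (remainder Vs Es t) S ->
  S.1 != set0 -> ewt H S.2 <= alpha t * vwt H S.1.
Proof.
have [/(_ t)[[_ _ dmax] _] /(_ t) -> _ _] := hspec => subS S0.
by rewrite -ler_pdivrMr ?vwt_gt0 //; apply: dmax.
Qed.

Variables (rv : 'I_n -> 'I_k) (re : 'I_m -> 'I_k).
Hypothesis rvE : forall j r, (j \in Vs r) = (rv j == r).
Hypothesis reE : forall i r, (i \in Es r) = (re i == r).

Lemma remainder_vertex_le t j : (j \in (remainder Vs Es t).1) = (t <= rv j)%N.
Proof. exact: mem_rest_label. Qed.

Lemma remainder_edge_le t i : (i \in (remainder Vs Es t).2) = (t <= re i)%N.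
Proof. exact: mem_rest_label. Qed.

(** A vertex of a later factor would still be present at stage [re i], so the subgraph condition
    would put it in the factor of [i]. *)
Lemma supp_label_le i j : j \in supp H i -> (rv j <= re i)%N.
Proof.
move=> ji; rewrite leqNgt; apply/negP => lt_ij.
have [_ _ /(_ i)] := spectral_subgraph (re i).
rewrite reE eqxx => /(_ isT)/subsetP/(_ j).
rewrite in_setI ji remainder_vertex_le (ltnW lt_ij) rvE => /(_ isT)/eqP eq_ij.
by rewrite eq_ij ltnn in lt_ij.
Qed.

(* Otherwise [i] could be added for free to the last factor that meets its
   support, making that factor denser. *)
Lemma supp_meets_factor i :
  supp H i != set0 -> exists2 j, j \in supp H i & rv j = re i.
Proof.
case/set0Pn=> j0 j0i.
have [j ji jmax] : exists2 j, j \in supp H i &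
    forall y, y \in supp H i -> (rv y <= rv j)%N.
  by case: (arg_maxnP (fun j => val (rv j)) j0i) => j ji h; exists j.
exists j => //; apply/eqP/negPn/negP => ne_ji; set s := rv j in ne_ji jmax.
have lt_si : (s < re i)%N by rewrite ltn_neqAle supp_label_le // andbT.
have [subV subE subS] := spectral_subgraph s.
have : ewt H (i |: Es s) <= alpha s * vwt H (Vs s).
  apply: (@spectral_ewt_le s (Vs s, i |: Es s)); last first.
    by apply/set0Pn; exists j; rewrite rvE.
  split=> //=; first by rewrite subUset sub1set remainder_edge_le ltnW.
  move=> x /setU1P[->|/subS//]; apply/subsetP=> y /setIP[yi].
  rewrite remainder_vertex_le rvE => le_sy; apply/eqP/val_inj/anti_leq.
  by rewrite le_sy jmax.
rewrite spectral_alpha_vwt /ewt big_setU1 ?reE 1?eq_sym //=.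
by rewrite gerDr leNgt eweight_gt0.
Qed.

Definition block_support : {set 'I_m * 'I_n} :=
  [set p | (p.2 \in supp H p.1) && (rv p.2 == re p.1)].

(** Both sides split over the factors. In each one, the chosen hyperedges and the vertices they
    reach there form a subgraph of the remainder, to which the density bound applies. *)
Lemma block_hall (hE : forall i, supp H i != set0) (G : {set 'I_m}) :
  \sum_(i in G) eweight H i <=
  \sum_(j in nbr block_support G) alpha (rv j) * vweight H j.
Proof.
rewrite (partition_big re xpredT) //= [leRHS](partition_big rv xpredT) //=.
apply: ler_sum => r _.
pose F := [set i in G | re i == r].
pose V := [set j in nbr block_support G | rv j == r].
rewrite (eq_bigr (fun j => alpha r * vweight H j)); last by move=> j /andP[_ /eqP->].
rewrite -mulr_sumr (eq_bigl (mem F)); last by move=> i; rewrite !inE.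
rewrite [in leRHS](eq_bigl (mem V)); last by move=> j; rewrite [RHS]inE.
have FV i : i \in F -> exists2 j, j \in supp H i & j \in V.
  rewrite inE => /andP[iG /eqP ir]; have [j ji jr] := supp_meets_factor (hE i).
  exists j => //; rewrite inE jr ir eqxx andbT.
  by apply/nbrP; exists i => //; rewrite inE ji jr /= eqxx.
(* The density bound requires a non-empty vertex set, which [supp_meets_factor] provides as soon as
   [F] is non-empty. *)
have [F0|[i iF]] := set_0Vmem F.
  by rewrite F0 big_set0 mulr_ge0 ?alpha_ge0 ?vwt_ge0.
apply: (@spectral_ewt_le r (V, F)); last first.
  by have [j _ jV] := FV i iF; apply/set0Pn; exists j.
split=> /=.
- by apply/subsetP=> j /setIdP[_ /eqP jr]; rewrite remainder_vertex_le jr.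
- by apply/subsetP=> x /setIdP[_ /eqP xr]; rewrite remainder_edge_le xr.
(* Supports only reach labels at most [r] and the remainder only keeps labels at least [r]. *)
move=> x /setIdP[xG /eqP xr]; apply/subsetP=> j /setIP[jx].
rewrite remainder_vertex_le => le_rj; have := supp_label_le jx; rewrite xr => le_jr.
have jr : rv j = r by apply/val_inj/anti_leq; rewrite le_rj le_jr.
rewrite inE jr eqxx andbT; apply/nbrP; exists x => //.
by rewrite inE jx jr xr /=.
Qed.

(** The equality holds factor by factor. Existence takes all factors for [P], and the block form
    takes an initial segment of them. *)
Lemma spectral_weight_balance (P : pred 'I_k) :
  \sum_(j | P (rv j)) alpha (rv j) * vweight H j =
  \sum_(i | P (re i)) eweight H i.
Proof.
rewrite (partition_big rv P) //= [RHS](partition_big re P) //=.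
apply: eq_bigr => r Pr.
rewrite (eq_bigr (fun j => alpha r * vweight H j)); last by move=> j /andP[_ /eqP->].
rewrite -mulr_sumr (eq_bigl (mem (Vs r))); last first.
  by move=> j; rewrite inE rvE andb_idl // => /eqP->.
rewrite spectral_alpha_vwt; apply: eq_bigl => i.
by rewrite reE andb_idl // => /eqP->.
Qed.

Lemma exists_block_matrix (hE : forall i, supp H i != set0) :
  exists A : 'M[R]_(m, n),
    is_support_matrix H A /\ forall j, colsum A j = alpha (rv j).
Proof.
have w0 j : 0 <= vweight H j by rewrite ltW // vweight_gt0.
have u0 i : 0 <= eweight H i by rewrite ltW // eweight_gt0.
have c0 j : 0 <= alpha (rv j) * vweight H j by rewrite mulr_ge0 ?alpha_ge0.
have wK j x : vweight H j * (x / vweight H j) = x.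
  by rewrite mulrC divfK // gt_eqF // vweight_gt0.
have [B [B0 BS Bu Bc]] := fractional_hall u0 c0 (block_hall hE).
(* Each column is at most its capacity and the totals agree, so no column has any slack. *)
have slack0 : \sum_j (alpha (rv j) * vweight H j - \sum_i B i j) = 0.
  rewrite sumrB (spectral_weight_balance xpredT) exchange_big /=.
  by rewrite (eq_bigr _ (fun i _ => Bu i)) subrr.
have Bcol j : \sum_i B i j = alpha (rv j) * vweight H j.
  apply/esym/subr0_eq/(psumr_eq0P _ slack0) => // y _.
  by rewrite subr_ge0.
(* [B i j] is the weight sent from [i] to [j], whereas rows of a support matrix are weighted by
   [vweight H j]; hence the division. *)
exists (\matrix_(i, j) (B i j / vweight H j)); split; first split.
- by move=> i j; rewrite mxE divr_ge0.
- move=> i j jNi; rewrite mxE BS ?mul0r //.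
  by rewrite inE negb_and jNi.
- by move=> i; rewrite -Bu; apply: eq_bigr => j _; rewrite mxE wK.
move=> j; rewrite /colsum; under eq_bigr do rewrite mxE.
by rewrite -mulr_suml Bcol mulfK // gt_eqF // vweight_gt0.
Qed.

(* The columns labelled at most [t] have the same total weight as the rows
   labelled at most [t], and these rows are supported in these columns; so
   nothing is left in these columns for the other rows. *)
Lemma support_matrix_block (A : 'M[R]_(m, n)) :
    is_support_matrix H A -> (forall j, colsum A j = alpha (rv j)) ->
  forall i j, rv j != re i -> A i j = 0.
Proof.
case=> A0 Asupp Arow Acol i j ne_ji.
have wA0 x y : 0 <= vweight H y * A x y by rewrite mulr_ge0 // ltW // vweight_gt0.
have [/supp_label_le le_ji|/Asupp//] := boolP (j \in supp H i).
have lt_ji : (rv j < re i)%N by rewrite ltn_neqAle ne_ji.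
pose t := rv j; pose lo (r : 'I_k) := (r <= t)%N.
have lowrow x : lo (re x) ->
    \sum_(y | lo (rv y)) vweight H y * A x y = eweight H x.
  move=> lx; rewrite -Arow [RHS](bigID (fun y => lo (rv y))) /=.
  rewrite [X in _ + X]big1 ?addr0 // => y ly; rewrite Asupp ?mulr0 //.
  by apply: contra ly => /supp_label_le /leq_trans; apply.
have balance : \sum_(x | ~~ lo (re x)) \sum_(y | lo (rv y)) vweight H y * A x y = 0.
  apply: (@addrI _ (\sum_(x | lo (re x)) eweight H x)); rewrite addr0.
  rewrite -[in LHS](eq_bigr _ lowrow) -(bigID (fun x => lo (re x)) xpredT) /=.
  rewrite exchange_big -spectral_weight_balance; apply: eq_bigr => y _.
  by rewrite -mulr_sumr -/(colsum A y) Acol mulrC.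
have row0 : \sum_(y | lo (rv y)) vweight H y * A i y = 0.
  apply: (psumr_eq0P _ balance) => [x _|]; first exact: sumr_ge0.
  by rewrite /lo -ltnNge.
have /eqP : vweight H j * A i j = 0.
  by apply: (psumr_eq0P _ row0) => //; rewrite /lo.
by rewrite mulf_eq0 gt_eqF ?vweight_gt0 //= => /eqP.
Qed.

End SpectralFactors.

Theorem theorem7 (R : realType) (n m : nat) (H : whypergraph R n m)
    (hV : forall j : 'I_n, exists i : 'I_m, j \in supp H i)
    (hE : forall i : 'I_m, supp H i != set0)
    (k : nat) (alpha : 'I_k -> R)
    (Vs : 'I_k -> {set 'I_n}) (Es : 'I_k -> {set 'I_m})
    (hspec : spectral_decomposition H alpha Vs Es) :
  (exists A : 'M[R]_(m, n),
     is_support_matrix H A /\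
     (forall (r : 'I_k) (j : 'I_n), j \in Vs r -> colsum A j = alpha r)) /\
  (forall A : 'M[R]_(m, n),
     is_support_matrix H A ->
     (forall (r : 'I_k) (j : 'I_n), j \in Vs r -> colsum A j = alpha r) ->
     forall (i : 'I_m) (j : 'I_n),
       ~ (exists r : 'I_k, j \in Vs r /\ i \in Es r) -> A i j = 0).
Proof.
have [rv rvE] := spectral_vertex_label hspec.
have [re reE] := spectral_edge_label hspec.
split=> [|A suppA colA i j nblock].
  have [A [suppA colA]] := exists_block_matrix hspec rvE reE hE.
  by exists A; split=> // r j; rewrite rvE colA => /eqP->.
apply: (support_matrix_block hspec rvE reE suppA) => [y|].
  by apply: colA; rewrite rvE.
by apply/eqP => eq_ji; apply: nblock; exists (re i); rewrite rvE reE eq_ji.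
Qed.
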